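(* The learned pattern similarity (LPS) is a kernel. That is, let $\mathcal{X}$ be a non-empty set of multivariate time series of length $T$ and let $S:\mathcal{X}\times\mathcal{X}\to\mathbb{R}$, $$S(X,X')=\frac{1}{RJ}\sum_{r=1}^{R}\sum_{j=1}^{J}\min\bigl(h_{r,j}(X),h_{r,j}(X')\bigr),$$ be the LPS similarity, where $h_{r,j}(X)\in\mathbb{N}_0$ is the number of segments of $X$ contained in leaf $r$ of tree $j$. Then there exist a real Hilbert space $\mathcal{H}$ and a map $\Phi:\mathcal{X}\to\mathcal{H}$ such that $S(X,X')=\langle\Phi(X),\Phi(X')\rangle_{\mathcal{H}}$ for all $X,X'\in\mathcal{X}$.
   Context: LPS uses a fixed (already trained) ensemble of $J\ge 1$ regression trees, each having $R\ge 1$ leaves. For each tree $j$, every time series $X\in\mathcal{X}$ is decomposed into finitely many segments of a given length, the number of segments depending only on the time series length and the segment length and not on $X$; each segment of $X$ is routed by tree $j$ to exactly one of its leaves. The number of segments of $X$ contained in leaf $r$ of tree $j$ is $h_{r,j}(X)\in\mathbb{N}_0=\{0,1,2,\dots\}$. The LPS representation of $X$ is the frequency vector $H(X)=[h_{1,1}(X),\dots,h_{R,J}(X)]\in\mathbb{N}_0^{RJ}$. Definition (kernel). For a non-empty set $\mathcal{X}$, a function $k:\mathcal{X}\times\mathcal{X}\to\mathbb{R}$ is a kernel if there exist a real Hilbert space $\mathcal{H}$ and a map $\Phi:\mathcal{X}\to\mathcal{H}$ with $k(x,y)=\langle\Phi(x),\Phi(y)\rangle_{\mathcal{H}}$ for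 all $x,y\in\mathcal{X}$. *)

(* Defs.v *)
From HB Require Import structures.
From mathcomp Require Import all_boot all_order all_algebra.
From mathcomp Require Import all_classical all_reals all_analysis.

Set Implicit Arguments.
Unset Strict Implicit.
Unset Printing Implicit Defensive.

Import Order.TTheory GRing.Theory Num.Theory.
Import numFieldNormedType.Exports.

Local Open Scope classical_set_scope.
Local Open Scope ring_scope.

(* A symmetric positive definite bilinear form that induces the norm of the
   complete normed space on which it is defined. *)
Record hilbert (K : realType) := Hilbert {
  hilbert_space :> completeNormedModType K ;
  inner : {dot hilbert_space for idfun} ;
  inner_norm : forall x : hilbert_space, inner x x = `|x| ^+ 2 }.

Definition is_kernel (K : realType) (X : Type) (k : X -> X -> K) : Prop :=
  exists (H : hilbert K) (Phi : X -> H),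
    forall x y : X, k x y = inner H (Phi x) (Phi y).

(* Multivariate time series of length T with d real-valued attributes: the
   columns are the time points, the rows the attributes. *)
Definition time_series (K : realType) (d T : nat) : Type := 'M[K]_(d, T).

(* Binary regression trees on V: a node sends the points that pass its test to
   the first subtree and the others to the second; a leaf carries the predicted
   value. *)
Inductive regression_tree (K V : Type) : Type :=
| Leaf of K
| Node of (V -> bool) & regression_tree K V & regression_tree K V.

Fixpoint nleaves (K V : Type) (t : regression_tree K V) : nat :=
  match t with
  | Leaf _ => 1
  | Node _ t1 t2 => nleaves t1 + nleaves t2
  end.

(* The leaf reached by v, the leaves being numbered from left to right. *)
Fixpoint leaf_index (K V : Type) (t : regression_tree K V) (v : V) : nat :=
  match t with
  | Leaf _ => 0
  | Node p t1 t2 =>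
      if p v then leaf_index t1 v else nleaves t1 + leaf_index t2 v
  end.

Lemma leaf_index_lt (K V : Type) (t : regression_tree K V) (v : V) :
  (leaf_index t v < nleaves t)%N.
Proof.
elim: t => //= p t1 IH1 t2 IH2; case: ifP => _; last by rewrite ltn_add2l.
exact: leq_trans IH1 (leq_addr _ _).
Qed.

(* A tree with R leaves together with the decomposition of the time series that
   feeds it.  A segment records seg_dim values at each of seg_len time steps:
   seg_dim need not be d, since segments may be taken from a single attribute
   or from additional series such as the differenced one.  nseg gives the
   number of segments from the lengths of the series and of the segments. *)
Record lps_tree (K : realType) (d T R : nat) (nseg : nat -> nat -> nat) :=
  LPSTree {
    seg_dim : nat ;
    seg_len : nat ;
    segments : time_series K d T -> (nseg T seg_len).-tuple 'M[K]_(seg_dim, seg_len) ;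
    tree : regression_tree K 'M[K]_(seg_dim, seg_len) ;
    tree_nleaves : nleaves tree = R }.

Record lps_ensemble (K : realType) (d T R J : nat) := LPSEnsemble {
  nseg : nat -> nat -> nat ;
  trees : 'I_J -> lps_tree K d T R nseg }.

(* h_{r,j}(X); leaves and trees are numbered from 0. *)
Definition leaf_count (K : realType) (d T R J : nat) (E : lps_ensemble K d T R J)
    (r : 'I_R) (j : 'I_J) (X : time_series K d T) : nat :=
  count (fun s => leaf_index (tree (trees E j)) s == r)
    (segments (trees E j) X).

Definition lps_similarity (K : realType) (d T R J : nat)
    (E : lps_ensemble K d T R J) (X X' : time_series K d T) : K :=
  (R * J)%:R^-1 *
  \sum_(r < R) \sum_(j < J)
    (minn (leaf_count E r j X) (leaf_count E r j X'))%:R.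

(* Main.v *)
(* Since min(a, b) = \sum_(m < M) [m < a] [m < b] as soon as a <= M, and the counts
   h_{r,j} are bounded by the number of segments, LPS is the Euclidean inner
   product of the finite vectors with entries (RJ)^(-1/2) [m < h_{r,j}(X)],
   indexed by (r, j, m). *)
Require Import Defs.
From HB Require Import structures.
From mathcomp Require Import all_boot all_order all_algebra.
From mathcomp Require Import all_classical all_reals all_analysis.
From mathcomp Require Import ring.
Import Order.TTheory GRing.Theory Num.Theory.
Import numFieldNormedType.Exports.
Local Open Scope classical_set_scope.
Local Open Scope ring_scope.

Section dot_product.
Set Implicit Arguments.
Unset Strict Implicit.
Variables (K : realType) (n : nat).
Implicit Types u v w : 'rV[K]_n.

Definition dotv u v : K := \sum_i u 0 i * v 0 i.

Lemma dotvC u v : dotv u v = dotv v u.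
Proof. by apply: eq_bigr => i _; rewrite mulrC. Qed.

Lemma dotvPr u a v w : dotv u (a *: v + w) = a * dotv u v + dotv u w.
Proof.
rewrite /dotv mulr_sumr -big_split; apply: eq_bigr => i _ /=.
by rewrite !mxE mulrDr mulrCA.
Qed.

Lemma dotvPl u a v w : dotv (a *: v + w) u = a * dotv v u + dotv w u.
Proof. by rewrite dotvC dotvPr !(dotvC u). Qed.

Lemma dotv_ge0 u : 0 <= dotv u u.
Proof. by apply: sumr_ge0 => i _; rewrite -expr2 sqr_ge0. Qed.

(** The other terms of the sum are squares. This bound yields both definiteness and the domination
    of the sup norm. *)
Lemma sqr_coord_le_dotv u i : u 0 i ^+ 2 <= dotv u u.
Proof.
rewrite /dotv (bigD1 i) //= -expr2 lerDl.
by apply: sumr_ge0 => j _; rewrite -expr2 sqr_ge0.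
Qed.

Lemma dotv_eq0 u : dotv u u = 0 -> u = 0.
Proof.
move=> u0; apply/rowP => i; rewrite mxE; apply/eqP.
by rewrite -sqrf_eq0 eq_le sqr_ge0 andbT -u0 sqr_coord_le_dotv.
Qed.

Lemma dotv_gt0 u : u != 0 -> 0 < dotv u u.
Proof.
move=> u_neq0; rewrite lt_neqAle dotv_ge0 andbT.
by apply: contra_neq u_neq0 => /esym/dotv_eq0.
Qed.

Lemma dotv_cauchy_schwarz u v : dotv u v ^+ 2 <= dotv u u * dotv v v.
Proof.
have [->|v_neq0] := eqVneq v 0.
  have d0 w : dotv w 0 = 0 by apply: big1 => i _; rewrite mxE mulr0.
  by rewrite !d0 expr0n mulr0.
have d0 w : dotv 0 w = 0 by apply: big1 => i _; rewrite mxE mul0r.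
(* This vector is the component of u orthogonal to v, scaled by [dotv v v] to avoid a division; its
   square is [dotv v v] times the Cauchy-Schwarz defect. The trailing 0 gives the shape [a *: v + w]
   that [dotvPl] and [dotvPr] expand. *)
have := dotv_ge0 (dotv v v *: u + (- dotv u v *: v + 0)).
rewrite !(dotvPl, dotvPr) !(dotvC _ 0) !d0 (dotvC v u) => proj_ge0.
rewrite -subr_ge0 -(pmulr_rge0 _ (dotv_gt0 v_neq0)).
by apply: etrans proj_ge0; congr (0 <= _); ring.
Qed.

Definition dot_norm u : K := Num.sqrt (dotv u u).

Lemma sqr_dot_norm u : dot_norm u ^+ 2 = dotv u u.
Proof. by rewrite sqr_sqrtr ?dotv_ge0. Qed.

(** Squaring leaves only the cross terms to compare; a second squaring, after passing to the
    absolute value, turns that into Cauchy-Schwarz. *)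
Lemma dot_normD u v : dot_norm (u + v) <= dot_norm u + dot_norm v.
Proof.
rewrite -ler_sqr ?nnegrE ?addr_ge0 ?sqrtr_ge0 // sqrrD !sqr_dot_norm.
have -> : dotv (u + v) (u + v) = dotv u u + dotv u v *+ 2 + dotv v v.
  by rewrite -[u]scale1r !(dotvPl, dotvPr) !scale1r (dotvC v u); ring.
rewrite lerD2r lerD2l lerMn2r /=.
apply: le_trans (ler_norm _) _.
rewrite -ler_sqr ?nnegrE ?normr_ge0 ?mulr_ge0 ?sqrtr_ge0 //.
by rewrite exprMn !sqr_dot_norm real_normK ?num_real ?dotv_cauchy_schwarz.
Qed.

Lemma dot_norm_eq0 u : dot_norm u = 0 -> u = 0.
Proof. by move=> u0; apply: dotv_eq0; rewrite -sqr_dot_norm u0 expr0n. Qed.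

Lemma dot_normZ a u : dot_norm (a *: u) = `|a| * dot_norm u.
Proof.
rewrite /dot_norm -sqrtr_sqr -sqrtrM ?sqr_ge0 //; congr Num.sqrt.
by rewrite mulr_sumr; apply: eq_bigr => i _; rewrite !mxE; ring.
Qed.

Lemma dot_normMn u k : dot_norm (u *+ k) = dot_norm u *+ k.
Proof. by rewrite -scaler_nat dot_normZ normr_nat mulr_natl. Qed.

Lemma dot_normN u : dot_norm (- u) = dot_norm u.
Proof. by rewrite -scaleN1r dot_normZ normrN1 mul1r. Qed.

Lemma mx_norm_le_dot_norm u : `|u| <= dot_norm u.
Proof.
rewrite [leLHS]mx_normrE.
apply: bigmax_le => [|[i j] _ /=]; first exact: sqrtr_ge0.
by rewrite ord1 -sqrtr_sqr ler_sqrt ?dotv_ge0 ?sqr_coord_le_dotv.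
Qed.

(** The constant is crude (the square root of n would do), but [n.+1] is positive even for n = 0, so
    radii can be divided by it. *)
Lemma dot_norm_le_mx_norm u : dot_norm u <= n.+1%:R * `|u|.
Proof.
rewrite -ler_sqr ?nnegrE ?mulr_ge0 ?sqrtr_ge0 // sqr_dot_norm.
apply: (@le_trans _ _ (n%:R * `|u| ^+ 2)).
  rewrite -[X in X%:R * _](card_ord n) mulr_natl -sumr_const.
  apply: ler_sum => i _; rewrite -expr2 -[leLHS]real_normK ?num_real //.
  rewrite ler_sqr ?nnegrE // [leRHS]mx_normrE.
  exact: (le_bigmax _ (fun ij => `|u ij.1 ij.2|) (0, i)).
rewrite exprMn ler_wpM2r ?sqr_ge0 // -natrX ler_nat.
by rewrite (leq_trans (leqnSn n)) // -{1}(muln1 n.+1) expnS leq_mul2l expn1.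
Qed.

End dot_product.

(* The library gives ['rV_n] the sup norm; this copy carries the Euclidean norm
   but inherits the (equivalent) uniform structure, hence completeness. *)
Definition euclidean (K : realType) (n : nat) : Type := 'rV[K]_n.

Section euclidean_space.
Set Implicit Arguments.
Unset Strict Implicit.
Variables (K : realType) (n : nat).
Local Notation E := (euclidean K n).

HB.instance Definition _ := GRing.Lmodule.copy E 'rV[K]_n.
HB.instance Definition _ := Complete.copy E 'rV[K]_n.

HB.instance Definition _ := Num.Zmodule_isNormed.Build K E
  (@dot_normD K n) (@dot_norm_eq0 K n) (@dot_normMn K n) (@dot_normN K n).

Let euclidean_ball := ball_ (fun u : E => `|u|).

(** By the two norm comparisons, a Euclidean ball lies in the sup-norm ball of the same radius e and
    contains the one of radius e / (n + 1), so the inherited uniformity is that of the Euclidean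
    metric. *)
Let euclidean_entourage : entourage = entourage_ euclidean_ball.
Proof.
rewrite -[LHS](@entourage_ballE K 'rV[K]_n) -ball_normE.
apply/seteqP; split => A [e /= e0 eA].
  exists e => //= -[u v] /= uv; apply: eA => /=.
  exact: le_lt_trans (mx_norm_le_dot_norm _) uv.
exists (e / n.+1%:R) => /=; first by rewrite divr_gt0.
move=> [u v] /= uv; apply: eA; apply: le_lt_trans (dot_norm_le_mx_norm _) _.
by rewrite mulrC -ltr_pdivlMr.
Qed.

HB.instance Definition _ := Uniform_isPseudoMetric.Build K E
  (@ball_norm_center K E) (@ball_norm_symmetric K E) (@ball_norm_triangle K E)
  euclidean_entourage.
HB.instance Definition _ := NormedZmod_PseudoMetric_eq.Build K E erefl.
HB.instance Definition _ :=
  PseudoMetricNormedZmod_Lmodule_isNormedModule.Build K E (@dot_normZ K n).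

Let dotE : E -> E -> K := @dotv K n.

Let dotE_bilinear : bilinear_for *%R (idfun \; *%R) dotE.
Proof. by split=> u a v w; [exact: dotvPl | exact: dotvPr]. Qed.

Let dotE_hermitian (u v : E) : dotE u v = (-1) ^+ false * idfun (dotE v u).
Proof. by rewrite expr0 mul1r; exact: dotvC. Qed.

HB.instance Definition _ := bilinear_isBilinear.Build K E E K
  *%R (idfun \; *%R) dotE dotE_bilinear.
HB.instance Definition _ :=
  isHermitianSesquilinear.Build K E false idfun dotE dotE_hermitian.
HB.instance Definition _ := isDotProduct.Build K E dotE (@dotv_gt0 K n).

Definition euclidean_hilbert : hilbert K :=
  @Hilbert K E dotE (fun u => esym (sqr_dot_norm u)).

End euclidean_space.

(** The feature map lists the values f i x as coordinates, with I enumerated by [enum_val]. *)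
Lemma is_kernel_sum (K : realType) (X : Type) (I : finType) (f : I -> X -> K) :
  is_kernel (fun x y => \sum_i f i x * f i y).
Proof.
exists (euclidean_hilbert K #|I|), (fun x => \row_i f (enum_val i) x) => x y.
rewrite (reindex _ (onW_bij _ (@enum_val_bij I))) /=.
by apply: eq_bigr => i _; rewrite !mxE.
Qed.

(** A product of indicators is the indicator of i < min(a, b), and all these i lie below M because
    min(a, b) <= a <= M. *)
Lemma minn_sum_ltn (M a b : nat) : (a <= M)%N ->
  minn a b = (\sum_(i < M) (i < a) * (i < b))%N.
Proof.
move=> aM; rewrite -[LHS]card_ord -sum1_card.
rewrite (big_ord_widen M (fun=> 1%N)) ?geq_min ?aM //.
by rewrite big_mkcond; apply: eq_bigr => i _; rewrite mulnb -leq_min.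
Qed.

Theorem theorem2 (K : realType) (d T R J : nat) (R_gt0 : (0 < R)%N)
    (J_gt0 : (0 < J)%N) (E : lps_ensemble K d T R J)
    (XX : set (time_series K d T)) (XX_neq0 : XX !=set0) :
  is_kernel (fun X X' : XX => lps_similarity E (sval X) (sval X')).
Proof.
(* Segment lengths, hence segment numbers, may vary with the tree; the maximum bounds all counts at
   once. *)
pose M := (\max_(j < J) nseg E T (seg_len (trees E j)))%N.
pose c : K := Num.sqrt (R * J)%:R^-1.
pose f (i : 'I_R * 'I_J * 'I_M) (X : XX) : K :=
  c * (i.2 < leaf_count E i.1.1 i.1.2 (sval X))%:R.
suff -> : (fun X X' : XX => lps_similarity E (sval X) (sval X')) =
    (fun X X' => \sum_i f i X * f i X') by exact: is_kernel_sum.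
apply/funext => X; apply/funext => X'; rewrite /lps_similarity pair_bigA mulr_sumr.
(* The sum over triples becomes a sum over leaves (r, j) of sums over m, so that both sides are
   compared leaf by leaf. *)
rewrite -(pair_bigA _ (fun p m => f (p, m) X * f (p, m) X')) /=.
apply: eq_bigr => -[r j] _ /=.
rewrite (@minn_sum_ltn M) ?natr_sum ?mulr_sumr.
  apply: eq_bigr => m _; rewrite /f mulrACA -natrM -expr2.
  by rewrite sqr_sqrtr ?invr_ge0 ?ler0n.
rewrite /leaf_count (leq_trans (count_size _ _)) // size_tuple.
exact: (leq_bigmax j).
Qed.
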